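(* Let $X$ be a real linear space, let $F:X\rightrightarrows\overline{Y}$ and $G:X\rightrightarrows U$ be set-valued maps, let $S=\{x\in X : G(x)\cap(-D)\neq\emptyset\}$, and let $c\in\operatorname{int}C$ be fixed. If problem (P) is stable, then strong duality holds, that is, $$\operatorname{Sup}\bigcup_{u^*\in U^*}\phi(u^* )=\operatorname{Inf}\bigcup_{x\in S}F(x).$$
   Context: Spaces and cones. $Y$ is a (real) partially ordered linear topological space whose order is induced by a convex cone $C$ with $\emptyset\neq\operatorname{int}C\neq Y$. $\overline{Y}=Y\cup\{-\infty\}\cup\{+\infty\}$ with $-\infty\le y\le+\infty$ for all $y\in Y$. $U$ is a (real) separated locally convex space with topological dual $U^*$ and pairing $\langle u^*,u\rangle$. $D\subseteq U$ is a proper closed convex cone with nonempty interior, and $D^\circ=\{u^*\in U^* : \langle u^*,d\rangle\le 0\ \forall d\in D\}$ is its negative polar cone. A vector $c\in\operatorname{int}C$ is fixed. Sums of subsets of $\overline{Y}$ are elementwise (Minkowski) sums, with $A+\emptyset=\emptyset$, $y+(\pm\infty)=\pm\infty$ for $y\in Y$, and $(+\infty)+(-\infty)=+\infty$. Infimal and supremal sets. For $A\subseteq\overline{Y}$, the upper closure is $\operatorname{Cl}_+A=Y$ if $-\infty\in A$; $\operatorname{Cl}_+A=\emptyset$ if $A=\{+\infty\}$; and otherwise $\operatorname{Cl}_+A=\{y\in Y : \{y\}+\operatorname{int}C\subseteq (A\setminus\{+\infty\})+\operatorname{int}C\}$ (equivalently $\operatorname{cl}((A\setminus\{+\infty\})+C)$).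 For $A\subseteq Y$, $\operatorname{wMin}A=\{y\in A : (\{y\}-\operatorname{int}C)\cap A=\emptyset\}$. The infimal set is $\operatorname{Inf}A=\operatorname{wMin}\operatorname{Cl}_+A$ if $\emptyset\neq\operatorname{Cl}_+A\neq Y$; $\operatorname{Inf}A=\{-\infty\}$ if $\operatorname{Cl}_+A=Y$; $\operatorname{Inf}A=\{+\infty\}$ if $\operatorname{Cl}_+A=\emptyset$. The supremal set is defined symmetrically, $\operatorname{Sup}A=-\operatorname{Inf}(-A)$. Problem (P) is the problem with value $\bar p=\operatorname{Inf}\bigcup_{x\in S}F(x)$. Lagrangian and dual objective. $L:X\times U^*\rightrightarrows\overline{Y}$, $L(x,u^* )=F(x)+\operatorname{Inf}\bigcup_{u\in G(x)+D}\langle u^*,u\rangle\{c\}$, and $\phi(u^* )=\operatorname{Inf}\bigcup_{x\in X}L(x,u^* )$ for $u^*\in U^*$. Perturbation map. For $(x,u)\in X\times U$ put $\varphi(x,u)=F(x)$ if $G(x)\cap(-D-u)\neq\emptyset$ and $\varphi(x,u)=\emptyset$ otherwise. Define $W:U\rightrightarrows\overline{Y}$ by $W(u)=\operatorname{Inf}\bigcup_{x\in X}\varphi(x,u)$; thus $W(0)=\bar p$. Positive subgradient. For $(\bar u,\bar y)\in U\times Y$ with $\bar y\in W(\bar u)$, $\partial^+W(\bar u,\bar y)$ is the set of all $u^*\in-D^\circ$ such that $\bar y-\langle u^*,\bar u\rangle c\in\operatorname{Inf}\bigcup_{u\in U}(W(u)-\langle u^*,u\rangle c)$. Stability. (P)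 is called stable if $W(0)\neq\{+\infty\}$, $W(0)\neq\{-\infty\}$ and $\partial^+W(0,y)\neq\emptyset$ for all $y\in W(0)$. *)

(* Defs.v *)
From HB Require Import structures.
From mathcomp Require Import all_boot all_order all_algebra.
From mathcomp Require Import all_classical all_reals all_analysis.

Set Implicit Arguments.
Unset Strict Implicit.
Unset Printing Implicit Defensive.

Import Order.TTheory GRing.Theory Num.Theory.
Import numFieldNormedType.Exports.

Local Open Scope classical_set_scope.
Local Open Scope ring_scope.

Definition set_add (V : nmodType) (A B : set V) : set V :=
  [set a + b | a in A & b in B].

(* [dual_adde] is the addition of [\bar Y] with (+oo) + (-oo) = +oo. *)
Definition eset_add (Y : nmodType) (A B : set (\bar Y)) : set (\bar Y) :=
  [set dual_adde a b | a in A & b in B].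

Definition convex_cone (R : realType) (V : lmodType R) (K : set V) : Prop :=
  [/\ K !=set0, convex_set (K : set (convex_lmodType V))
    & forall (t : R) (x : V), 0 <= t -> K x -> K (t *: x)].

Record topdual (R : realType) (U : tvsType R) := TopDual {
  topdual_fun :> {linear U -> R^o};
  topdual_continuous : continuous topdual_fun }.

Section Dual.
Context (R : realType) (U : tvsType R).

Lemma topdual_opp_continuous (us : topdual U) :
  continuous (\- us : {linear U -> R^o}).
Proof. by move=> u; apply: cvgN; exact: topdual_continuous. Qed.

Definition topdual_opp (us : topdual U) : topdual U :=
  TopDual (@topdual_opp_continuous us).

Definition neg_polar (D : set U) : set (topdual U) :=
  [set us | forall d, D d -> us d <= 0].

End Dual.

Section InfSup.
Context (R : realType) (Y : topologicalLmodType R) (C : set Y).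

Definition finite_part (A : set (\bar Y)) : set Y := [set y | A y%:E].

Definition upper_closure (A : set (\bar Y)) : set Y :=
  if `[< A -oo%E >] then setT
  else if `[< A = [set +oo%E] >] then set0
  else [set y | set_add [set y] C° `<=` set_add (finite_part A) C°].

Definition wMin (A : set Y) : set Y :=
  [set y | A y /\ [set y - k | k in C°] `&` A = set0].

Definition Inf (A : set (\bar Y)) : set (\bar Y) :=
  if `[< upper_closure A = setT >] then [set -oo%E]
  else if `[< upper_closure A = set0 >] then [set +oo%E]
  else [set y%:E | y in wMin (upper_closure A)].

Definition Sup (A : set (\bar Y)) : set (\bar Y) :=
  [set oppe z | z in Inf [set oppe a | a in A]].

End InfSup.

Section Problem.
Context (R : realType) (X : lmodType R) (Y : topologicalLmodType R).
Context (U : tvsType R) (C : set Y) (D : set U) (c : Y).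
Context (F : X -> set (\bar Y)) (G : X -> set U).

Definition feasible : set X :=
  [set x | G x `&` [set - d | d in D] !=set0].

Definition lagrangian (x : X) (us : topdual U) : set (\bar Y) :=
  eset_add (F x)
    (Inf C [set ((us u : R) *: c)%:E | u in set_add (G x) D]).

Definition dual_objective (us : topdual U) : set (\bar Y) :=
  Inf C (\bigcup_x lagrangian x us).

Definition perturbation (x : X) (u : U) : set (\bar Y) :=
  if `[< G x `&` [set - d - u | d in D] !=set0 >] then F x else set0.

Definition value_map (u : U) : set (\bar Y) :=
  Inf C (\bigcup_x perturbation x u).

Definition pos_subgradient (ubar : U) (ybar : Y) : set (topdual U) :=
  [set us | neg_polar D (topdual_opp us) /\
    Inf C (\bigcup_u eset_add (value_map u) [set (- ((us u : R) *: c))%:E])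
      (ybar - (us ubar : R) *: c)%:E].

Definition stable : Prop :=
  [/\ value_map 0 <> [set +oo%E], value_map 0 <> [set -oo%E]
    & forall y : Y, value_map 0 y%:E -> pos_subgradient 0 y !=set0].

End Problem.

(* Main.v *)
Require Import Defs.
From HB Require Import structures.
From mathcomp Require Import all_boot all_order all_algebra.
From mathcomp Require Import all_classical all_reals all_analysis.

(** An infimal set [Inf A] carries exactly the information of the open upper
    set [up A], which is [A + int C] (everything if [A] contains [-oo]): the
    finite points of [Inf A] form the weak frontier of [up A], i.e. the points
    outside [up A] all of whose strict majorants lie in it; [Inf A] is [{-oo}]
    or [{+oo}] when [up A] is everything or empty; and, conversely,
    [up (Inf A) = up A] ([Inf_finP], [Inf_NyP], [Inf_yP], [up_Inf]).  So nested
    infima can be dropped, and duality becomes inclusion of upper sets.  (In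
    [A + int C] the value [+oo] contributes nothing.)

    Let [P] be the union of the [F x] over feasible [x], [L us] the union of the
    Lagrangian sets [L(x, us)] over all [x], and [V us] the union over [u] of
    the shifted values [W(u) - <us, u> c].  Two inclusions hold for every [us],
    the first as soon as [-oo] is not in [P], which stability ensures:

        up P `<=` up (L us)        ([weak_duality])
        up (L us) `<=` up (V us)   ([value_map_bound])

    The first holds because [0] lies in [G x + D] when [x] is feasible.  The
    second holds because [x] is feasible for the perturbation [u] exactly when
    [- u] lies in [G x + D], so a point [f + <us, u'> c] contributing to the
    Lagrangian, with [u'] in [G x + D], also contributes to the term of [V us]
    at [u = - u'].

    Now let [y] be a finite point of [Inf P] and [us] a positive subgradient
    there, so that [y] is in [Inf (V us)].  Then [y] is not in [up (V us)],
    hence not in [up (L us)], while all strict majorants of [y] are in [up P],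
    hence in [up (L us)]: [y] belongs to the dual value at [us].  Thus the union
    [Phi] of the dual values contains the weak frontier of [up P], and by weak
    duality it avoids [up P].  These two facts already force [Sup Phi] to be
    that frontier ([Sup_eq_Inf]), since the points strictly below [Phi] are then
    precisely those outside the upper closure of [up P]. *)

Set Implicit Arguments.
Unset Strict Implicit.

Import Order.TTheory GRing.Theory Num.Theory.
Import numFieldNormedType.Exports.

Local Open Scope classical_set_scope.
Local Open Scope ring_scope.

(** * Continuity of the operations of a topological module *)

Section TopologicalLmodule.
Context (R : realType) (Y : topologicalLmodType R).
Context (T : Type) (E : set_system T) (EF : Filter E).

Lemma cvg_addv (f g : T -> Y) (a b : Y) :
  f @ E --> a -> g @ E --> b -> (fun t => f t + g t) @ E --> a + b.
Proof.
move=> fa gb; apply: (@continuous2_cvg _ _ _ _ E _ f g +%R) => //.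
exact: (@add_continuous Y (a, b)).
Qed.

Lemma cvg_scalev (s : T -> R^o) (g : T -> Y) (r : R^o) (b : Y) :
  s @ E --> r -> g @ E --> b -> (fun t => s t *: g t) @ E --> (r : R) *: b.
Proof.
move=> sr gb.
apply: (@continuous2_cvg _ _ _ _ E _ s g
  (fun (r : R^o) (y : Y) => r *: y)) => //.
exact: (@scale_continuous R Y (r, b)).
Qed.

End TopologicalLmodule.

(** * The interior of a convex cone *)

Section ConeInterior.
Context (R : realType) (Y : topologicalLmodType R) (C : set Y).
Context (C_cone : convex_cone C).

Lemma convex_cone_add (x y : Y) : C x -> C y -> C (x + y).
Proof.
case: C_cone => _ convC coneC Cx Cy.
have half_ge0 : 0 <= 2^-1 :> R by rewrite invr_ge0.
have half_le1 : 2^-1 <= 1 :> R by rewrite invf_le1 ?ler1n.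
have : C (2^-1 *: x + (1 - 2^-1) *: y) :=
  set_mem (convC x y (Itv01 half_ge0 half_le1) (mem_set Cx) (mem_set Cy)).
have -> : 1 - 2^-1 = 2^-1 :> R by rewrite [X in X - _](splitr 1) mul1r addrK.
rewrite -scalerDr => /(coneC 2 _ (ler0n _ _)).
by rewrite scalerA mulfV ?pnatr_eq0// scale1r.
Qed.

Lemma interior_cone_scale (t : R) (k : Y) : 0 < t -> C° k -> C° (t *: k).
Proof.
case: C_cone => _ _ coneC t0 Ck.
have cts : (t^-1 *: z) @[z --> t *: k] --> t^-1 *: (t *: k).
  by apply: cvg_scalev; [exact: cvg_cst | exact: cvg_id].
rewrite scalerA mulVf ?gt_eqF// scale1r in cts.
have : nbhs (t *: k) [set z | C (t^-1 *: z)] by exact: cts.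
apply: filterS => z /= /(coneC t _ (ltW t0)).
by rewrite scalerA mulfV ?gt_eqF// scale1r.
Qed.

Lemma interior_cone_addr (k x : Y) : C° k -> C x -> C° (k + x).
Proof.
move=> Ck Cx.
have cts : (z - x) @[z --> k + x] --> k + x - x.
  by apply: cvg_addv; [exact: cvg_id | exact: cvg_cst].
rewrite addrK in cts.
have : nbhs (k + x) [set z | C (z - x)] by exact: cts.
by apply: filterS => z /= /convex_cone_add/(_ Cx); rewrite subrK.
Qed.

Lemma interior_cone_add (k l : Y) : C° k -> C° l -> C° (k + l).
Proof. by move=> Ck /interior_subset; exact: interior_cone_addr. Qed.

(** The interior is open and [t |-> k - t *: v] is continuous at [0]. *)
Lemma interior_cone_sub_small (k v : Y) :
  C° k -> exists2 e : R, 0 < e & C° (k - e *: v).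
Proof.
move=> Ck.
have cts : (k + t *: - v) @[t --> (0 : R^o)] --> k + (0 : R) *: - v.
  apply: cvg_addv; first exact: cvg_cst.
  by apply: cvg_scalev; [exact: cvg_id | exact: cvg_cst].
rewrite scale0r addr0 in cts.
have : nbhs (0 : R^o) [set t | C° (k + t *: - v)].
  by apply: cts; exact: nbhs_interior.
case/nbhs_ballP => e /= e0 eC; exists (e / 2); first exact: divr_gt0.
rewrite -scalerN; apply: eC; rewrite /ball/= sub0r normrN.
by rewrite gtr0_norm ?divr_gt0// ltr_pdivrMr// mulr_natr mulr2n ltrDl.
Qed.

(** For small [e] the point [c + e *: y] stays in the interior; rescale it by
    [e^-1]. *)
Lemma interior_cone_absorbing (c y : Y) :
  C° c -> exists2 t : R, 0 < t & C° (y + t *: c).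
Proof.
move=> /(interior_cone_sub_small (- y))[e e0 Ce].
exists e^-1; first by rewrite invr_gt0.
have := @interior_cone_scale e^-1 _ _ Ce; rewrite invr_gt0 => /(_ e0).
by rewrite scalerBr !scalerN opprK scalerA mulVf ?gt_eqF// scale1r addrC.
Qed.

End ConeInterior.

(** * Open upper sets and their weak frontiers *)

Section UpperSets.
Context (R : realType) (Y : topologicalLmodType R) (C : set Y) (c : Y).
Context (C_cone : convex_cone C) (c_int : C° c).

Definition cl_above (B : set Y) : set Y :=
  [set y | forall k, C° k -> B (y + k)].

Definition weak_frontier (B : set Y) : set Y := cl_above B `\` B.

(** Openness is only demanded along the direction [c]: together with upward
    closedness this is all that arguments along lines parallel to [c] need. *)
Record open_upset (B : set Y) : Prop := OpenUpset {
  open_upsetD : forall y k, B y -> C° k -> B (y + k);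
  open_upsetB : forall y, B y -> exists2 e : R, 0 < e & B (y - e *: c) }.

(** [B] is recovered from its upper closure as [cl_above B + int C]. *)
Lemma open_upset_cl_above (B : set Y) (y : Y) : open_upset B ->
  B y <-> exists2 k, C° k & cl_above B (y - k).
Proof.
move=> uB; split => [By|[k Ck /(_ _ Ck)]]; last by rewrite subrK.
have [e e0 Be] := open_upsetB uB By.
exists (e *: c); first exact: interior_cone_scale.
by move=> k; apply: open_upsetD.
Qed.

(** Going from [a] in the direction [c] one must enter [B], because [c]
    eventually dominates any vector.  The entrance time is an infimum: [B] is
    open along [c], so the entrance point is outside [B], and [B] is upward
    closed, so everything strictly above that point is inside. *)
Lemma weak_frontier_on_ray (B : set Y) (a b : Y) : open_upset B -> B b ->
  ~ B a -> exists2 t : R, 0 <= t & weak_frontier B (a + t *: c).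
Proof.
move=> uB Bb Ba.
pose T := [set t : R | B (a + t *: c)].
have T_ge0 : lbound T 0.
  move=> t Tt; rewrite leNgt; apply/negP => t0; apply: Ba.
  have /(open_upsetD uB Tt) : C° (- t *: c).
    by apply: interior_cone_scale; rewrite ?oppr_gt0.
  by rewrite scaleNr addrK.
have infT : has_inf T.
  split; last by exists 0.
  have [t _] := interior_cone_absorbing C_cone (a - b) c_int.
  move/(open_upsetD uB Bb) => Bt; exists t; rewrite /T/=.
  by rewrite addrA [b + _]addrC subrK in Bt.
exists (inf T); first by apply: lb_le_inf => //; case: infT.
split => [k Ck|/(open_upsetB uB)[e e0 Be]].
  have [e e0 Ce] := interior_cone_sub_small c Ck.
  have [t Tt tlt] := inf_adherent e0 infT.
  have := open_upsetD uB (open_upsetD uB Tt Ce).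
  move=> /(_ ((inf T + e - t) *: c)).
  rewrite -subr_gt0 in tlt => /(_ (interior_cone_scale C_cone tlt c_int)).
  congr (B _); rewrite scalerBl scalerDl addrACA [_ + e *: c]addrC.
  rewrite [k - _ - _]addrAC addrACA [e *: c + _]addrC addrK.
  by rewrite [a + t *: c + _]addrACA subrr addr0 addrAC.
have : T (inf T - e) by rewrite /T/= scalerBl addrA.
by move=> /(ge_inf infT.2); rewrite lerBrDr gerDl leNgt e0.
Qed.

(** Walk down from [b] in the direction [- c] to a point outside [B], which
    exists as [B] is not everything; the way back up to [b] crosses the weak
    frontier strictly before [b]. *)
Lemma open_upset_frontier (B : set Y) (b : Y) : open_upset B -> B <> setT ->
  B b -> exists2 e, weak_frontier B e & C° (b - e).
Proof.
move=> uB BT Bb; have [a Ba] : exists a, ~ B a.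
  by apply: contrapT => nB; apply: BT; rewrite -subTset => y _;
     apply: contrapT => By; apply: nB; exists y.
have [s _ Cs] := interior_cone_absorbing C_cone (a - b) c_int.
(* [b - s *: c] is strictly below [a], which is outside [B]. *)
have Bbs : ~ B (b - s *: c).
  by move=> /(open_upsetD uB)/(_ Cs); rewrite addrACA addNr addr0 addrC subrK.
have [t t0 Ft] := weak_frontier_on_ray uB Bb Bbs.
exists (b - s *: c + t *: c) => //.
have -> : b - (b - s *: c + t *: c) = (s - t) *: c.
  by rewrite opprD opprB addrA addrCA subrr addr0 scalerBl.
apply: interior_cone_scale => //; rewrite subr_gt0 ltNge; apply/negP => st.
case: Ft => _; apply; rewrite -addrA [- _ + _]addrC -scalerBl.
case: (eqVneq s t) => [->|neq]; first by rewrite subrr scale0r addr0.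
apply: (open_upsetD uB Bb); apply: interior_cone_scale => //.
by rewrite subr_gt0 lt_neqAle neq.
Qed.

(** Some [y + k] with [k] interior is still outside [B]; the ray from there
    meets the weak frontier, strictly above [y]. *)
Lemma not_cl_above_frontier (B : set Y) (b y : Y) : open_upset B -> B b ->
  ~ cl_above B y -> exists2 e, weak_frontier B e & C° (e - y).
Proof.
move=> uB Bb /existsNP[k /not_implyP[Ck Byk]].
have [t t0 Ft] := weak_frontier_on_ray uB Bb Byk.
exists (y + k + t *: c) => //.
rewrite -[y + k + _]addrA addrAC subrr add0r.
apply: interior_cone_addr => //.
by case: C_cone => _ _; apply => //; exact: interior_subset.
Qed.

(** * Infimal sets through upper sets *)

(** This set retains from [A] just what [Inf C A] depends on: [-oo] counts as
    strictly below every point, and [+oo] as below none. *)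
Definition up (A : set (\bar Y)) : set Y :=
  [set y | A -oo%E \/ exists2 p, A p%:E & C° (y - p)].

Lemma up_open_upset (A : set (\bar Y)) : open_upset (up A).
Proof.
split=> [y k [ANy|[p Ap Cp]] Ck|y [ANy|[p Ap Cp]]].
- by left.
- by right; exists p => //; rewrite addrAC; exact: interior_cone_add.
- by exists 1 => //; left.
- have [e e0 Ce] := interior_cone_sub_small c Cp.
  by exists e => //; right; exists p => //; rewrite addrAC.
Qed.

Lemma up_subset (A A' : set (\bar Y)) : A `<=` A' -> up A `<=` up A'.
Proof.
by move=> AA y [/AA|[p /AA Ap Cp]]; [left | right; exists p].
Qed.

Lemma up_translate (A A' : set (\bar Y)) (v y : Y) :
  (A -oo%E -> A' -oo%E) -> (forall p, A p%:E -> A' (v + p)%:E) ->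
  up A y -> up A' (v + y).
Proof.
move=> Ny fin [/Ny|[p /fin Ap Cp]]; first by left.
by right; exists (v + p) => //; rewrite opprD addrACA subrr add0r.
Qed.

Lemma upper_closureE (A : set (\bar Y)) : upper_closure C A = cl_above (up A).
Proof.
rewrite /upper_closure; case: asboolP => [ANy|ANy].
  by apply/seteqP; split => // y _ k _; left.
case: asboolP => [->|_].
  by apply/seteqP; split => // y /(_ _ c_int)[|[p]].
apply/seteqP; split => y H k.
  move=> Ck; have [|p Ap [l Cl <-]] := H (y + k).
    by exists y => //; exists k.
  by right; exists p => //; rewrite [p + l]addrC addrK.
case=> _ -> [l Cl <-]; have [//|[p Ap Cp]] := H l Cl.
by exists p => //; exists (y + l - p) => //; rewrite addrC subrK.
Qed.

Lemma cl_above_eqT (B : set Y) : open_upset B -> cl_above B = setT -> B = setT.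
Proof.
move=> uB BT; rewrite -subTset => y _; apply/(open_upset_cl_above y uB).
by exists c => //; rewrite BT.
Qed.

Lemma cl_above_eq0 (B : set Y) : open_upset B -> cl_above B = set0 -> B = set0.
Proof.
move=> uB B0; rewrite -subset0 => y By; rewrite -B0 => k Ck.
exact: open_upsetD.
Qed.

Lemma Inf_NyP (A : set (\bar Y)) : Inf C A -oo%E <-> up A = setT.
Proof.
have uA := up_open_upset A; rewrite /Inf upper_closureE; split.
  case: asboolP => [/(cl_above_eqT uA)//|_].
  by case: asboolP => [_ //|_ [y]].
move=> ->; case: asboolP => // -[]; by apply/seteqP; split.
Qed.

Lemma Inf_yP (A : set (\bar Y)) : Inf C A +oo%E <-> up A = set0.
Proof.
have uA := up_open_upset A; rewrite /Inf upper_closureE; split.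
  case: asboolP => [_ //|_].
  by case: asboolP => [/(cl_above_eq0 uA)//|_ [y]].
move=> ->; have cl0 : cl_above set0 = set0 :> set Y.
  by rewrite -subset0 => y /(_ _ c_int).
rewrite cl0; case: asboolP => [T0|_].
  by have : [set: Y] 0 by []; rewrite -T0.
by case: asboolP.
Qed.

Lemma Inf_infinite (A : set (\bar Y)) (z : \bar Y) :
  Inf C A z -> (forall y, z <> y%:E) -> Inf C A = [set z].
Proof.
rewrite /Inf; case: asboolP => [_ ->//|_].
by case: asboolP => [_ ->//|_ [y _ <-] /(_ y)].
Qed.

(** A point of [cl_above B] has another one strictly below it iff it lies in
    [cl_above B + int C], which is [B]. *)
Lemma wMin_cl_above (B : set Y) :
  open_upset B -> wMin C (cl_above B) = weak_frontier B.
Proof.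
move=> uB; apply/seteqP; split => y [clBy H]; split => //.
  move=> /(open_upset_cl_above y uB)[k Ck clB].
  by suff : set0 (y - k) by []; rewrite -H; split => //; exists k.
rewrite -subset0 => _ [[k Ck <-] clB]; apply: H.
by apply/(open_upset_cl_above y uB); exists k.
Qed.

Lemma Inf_finP (A : set (\bar Y)) (y : Y) :
  Inf C A y%:E <-> weak_frontier (up A) y.
Proof.
have uA := up_open_upset A; rewrite /Inf upper_closureE wMin_cl_above//; split.
  case: asboolP => [_ //|_].
  by case: asboolP => [_ //|_ [z Fz [<-]]].
move=> [clAy Ay]; case: asboolP => [/(cl_above_eqT uA) AT|_].
  by case: Ay; rewrite AT.
case: asboolP => [A0|_]; last by exists y.
by have := clAy; rewrite A0.
Qed.

(** A point of [up A] lies strictly above the weak frontier of [up A], unless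
    [up A] is everything, in which case [Inf C A] is [{-oo}]. *)
Lemma up_Inf (A : set (\bar Y)) : up (Inf C A) = up A.
Proof.
have uA := up_open_upset A.
have [AT|AT] := pselect (up A = setT).
  by rewrite AT -subTset => y _; left; apply/Inf_NyP.
apply/seteqP; split => y.
  case=> [/Inf_NyP//|[p /Inf_finP[clAp _] Cp]].
  by have := clAp _ Cp; rewrite addrC subrK.
move=> /(open_upset_frontier uA AT)[e Fe Ce].
by right; exists e => //; apply/Inf_finP.
Qed.

Lemma SupP (A : set (\bar Y)) (z : \bar Y) :
  Sup C A z <-> Inf C [set oppe a | a in A] (oppe z).
Proof.
split=> [[w Iw <-]|Iz]; first by case: w Iw => //= r; rewrite opprK.
by exists (oppe z) => //; case: z {Iz} => //= r; rewrite opprK.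
Qed.

(** The points strictly below [Phi] are exactly those outside
    [cl_above (up P)]: none is inside since [Phi] avoids [up P], and every point
    outside lies strictly below the weak frontier of [up P], hence below [Phi].
    So [Sup C Phi] consists of the points of [cl_above (up P)] strictly below
    which this set has no element, and these also make up [Inf C P]. *)
Lemma Sup_eq_Inf (P Phi : set (\bar Y)) :
  up P <> setT -> up P <> set0 -> ~ Phi +oo%E ->
  (forall z, Phi z%:E -> ~ up P z) ->
  (forall y, Inf C P y%:E -> Phi y%:E) ->
  Sup C Phi = Inf C P.
Proof.
set B := up P => BT /eqP/set0P[b Bb] Phiy PhiB PPhi.
have uB : open_upset B := up_open_upset P.
have upPhi : up [set oppe a | a in Phi] = [set y | ~ cl_above B (- y)].
  apply/seteqP; split => y.
    case=> [[[z| |] //= Phiz]|[p [[z| |] //= Phiz [zp]] Cp]] //.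
    move=> /(_ _ Cp); rewrite addKr -zp opprK; exact: PhiB.
  move=> /(not_cl_above_frontier uB Bb)[e Fe Ce].
  right; exists (- e); last by rewrite opprK addrC -[y in _ + y]opprK.
  by exists e%:E => //; apply: PPhi; apply/Inf_finP.
have clB0 : cl_above B b by move=> k; exact: open_upsetD.
apply/seteqP; split => -[y| |] /=.
- move=> /SupP/Inf_finP; rewrite upPhi => -[H /contrapT clBy].
  rewrite opprK in clBy; apply/Inf_finP; split => //.
  move=> /(open_upset_cl_above y uB)[k /H].
  by rewrite /= opprD opprK.
- move=> /SupP/Inf_NyP; rewrite upPhi => T.
  have : [set: Y] (- b) by [].
  by rewrite -T/= opprK.
- move=> /SupP/Inf_yP; rewrite upPhi => E0; case: BT.
  apply: cl_above_eqT => //; rewrite -subTset => y _; apply: contrapT => ncl.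
  by suff : set0 (- y) by []; rewrite -E0/= opprK.
- move=> /Inf_finP[clBy nBy]; apply/SupP/Inf_finP; rewrite upPhi; split.
    move=> k Ck /=; rewrite opprD opprK => clB; apply: nBy.
    by apply/(open_upset_cl_above y uB); exists k.
  by rewrite /= opprK; apply.
- by move=> /Inf_yP B0; move: Bb; rewrite /B B0.
- by move=> /Inf_NyP.
Qed.

End UpperSets.

(** * Duality inclusions *)

Section Duality.
Context (R : realType) (X : lmodType R) (Y : topologicalLmodType R).
Context (U : tvsType R) (C : set Y) (D : set U) (c : Y).
Context (F : X -> set (\bar Y)) (G : X -> set U).
Context (C_cone : convex_cone C) (c_int : C° c).
Implicit Types (x : X) (y : Y) (us : topdual U).

Let penalties us x : set (\bar Y) :=
  [set ((us u : R) *: c)%:E | u in set_add (G x) D].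

Lemma lagrangian_up us x (f y : Y) : F x f%:E ->
  up C (penalties us x) y -> up C (lagrangian C D c F G x us) (f + y).
Proof.
move=> Ff; rewrite -(up_Inf C_cone c_int) /lagrangian -/(penalties us x).
apply: up_translate => [ANy|p Ap]; exists f%:E => //.
  by exists -oo%E.
by exists p%:E.
Qed.

(** The infimum inside the Lagrangian is invisible to [up] by [up_Inf].  The
    first alternative records the value [-oo] of [F x]: as [-oo] plus [+oo] is
    [+oo], it survives in the sum only if the inner infimum is not [+oo], that
    is, if some [u] is admitted in it. *)
Lemma up_lagrangian us x y : up C (lagrangian C D c F G x us) y ->
  (F x -oo%E /\ set_add (G x) D !=set0) \/
  (exists2 f, F x f%:E & up C (penalties us x) (y - f)).
Proof.
have inf_penalties_lty m : Inf C (penalties us x) m -> m <> +oo%E ->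
    set_add (G x) D !=set0.
  move=> Im my; apply/set0P/eqP => GD0.
  have v0 : up C (penalties us x) = set0.
    rewrite -subset0 => z; rewrite /penalties GD0 image_set0.
    by case => [|[p]].
  case: m Im my => [m /(Inf_finP C_cone c_int)[/(_ _ c_int)]| //
                   |/(Inf_NyP C_cone c_int)]; rewrite v0 // => T0 _.
  by have : [set: Y] 0 by []; rewrite -T0.
case=> [|[p]].
  case=> -[f| |] Ff [[m| |] Im] //= _.
  - by right; exists f => //; rewrite -(up_Inf C_cone c_int); left.
  - by left; split => //; exact: inf_penalties_lty Im _.
  - by left; split => //; exact: inf_penalties_lty Im _.
case=> -[f| |] Ff [[m| |] Im] //= [<-] Cp; right; exists f => //.
rewrite -(up_Inf C_cone c_int); right; exists m => //.
by rewrite -addrA -opprD.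
Qed.

Lemma value_map0 :
  value_map C D F G 0 = Inf C (\bigcup_(x in feasible D G) F x).
Proof.
congr (Inf C _); rewrite /perturbation /feasible.
have -> : [set - d - 0 | d in D] = [set - d | d in D].
  by apply: eq_imagel => d _; rewrite subr0.
apply/seteqP; split => z [x Dx Fz]; exists x => //; move: Fz.
- by case: asboolP.
- by case: asboolP.
- by case: asboolP.
Qed.

(** For feasible [x] the penalty terms [<us, u> c] include the one at [u = 0],
    so that [L(x, us)] has points weakly below those of [F x]. *)
Lemma weak_duality us :
  ~ (\bigcup_(x in feasible D G) F x) -oo%E ->
  up C (\bigcup_(x in feasible D G) F x) `<=`
  up C (\bigcup_x lagrangian C D c F G x us).
Proof.
move=> PNy y [//|[f [x [g [Gg [d Dd dE]]] Ff] Cf]].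
apply: (@up_subset _ _ C (lagrangian C D c F G x us)).
  by move=> z Lz; exists x.
rewrite -(subrK f y) addrC; apply: lagrangian_up => //.
right; exists 0; last by rewrite subr0.
exists 0; last by rewrite linear0 scale0r.
by exists g => //; exists d; rewrite -?dE ?addNr.
Qed.

(** If [u'] is in [G x + D], then [x] is admissible for the perturbation [- u'],
    so [up (W(- u'))] contains all strict majorants of [F x].  Shifting by
    [- <us, - u'> c = <us, u'> c] gives the part of [up (L(x, us))] coming from
    [u']. *)
Lemma value_map_bound us : up C (\bigcup_x lagrangian C D c F G x us) `<=`
  up C (\bigcup_u eset_add (value_map C D F G u)
                           [set (- ((us u : R) *: c))%:E]).
Proof.
set V := (X in _ `<=` up _ X).
have Vup (u : U) y : up C (\bigcup_x perturbation D F G x (- u)) y ->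
    up C V ((us u : R) *: c + y).
  rewrite -(up_Inf C_cone c_int); apply: up_translate => [WNy|p Wp].
    exists (- u) => //; exists -oo%E => //.
    by exists (- ((us (- u) : R) *: c))%:E.
  exists (- u) => //; exists p%:E => //.
  exists (- ((us (- u) : R) *: c))%:E => //=.
  by rewrite linearN scaleNr opprK addrC.
have perturbed x g d : G x g -> D d ->
    F x `<=` \bigcup_x perturbation D F G x (- (g + d)).
  move=> Gg Dd z Fz; exists x => //; rewrite /perturbation.
  case: asboolP => // -[]; exists g; split => //; exists d => //.
  by rewrite opprK addrC addrK.
have LV x y : up C (lagrangian C D c F G x us) y -> up C V y.
  case/up_lagrangian=> [[FNy [_ [g Gg [d Dd _]]]]|[f Ff]].
    rewrite -[y](subrKC ((us (g + d) : R) *: c)); apply: Vup.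
    by left; exact: perturbed FNy.
  case=> [[u _]//|[_ [_ [g Gg [d Dd <-]] [<-]] Cy]].
  rewrite -[y](subrKC ((us (g + d) : R) *: c)); apply: Vup.
  by right; exists f; [exact: perturbed Ff | rewrite addrAC].
move=> y [[x _ Lx]|[p [x _ Lx] Cp]]; apply: (LV x); first by left.
by right; exists p.
Qed.

End Duality.

Unset Implicit Arguments.
Set Strict Implicit.

Theorem theorem3p7 (R : realType) (X : lmodType R)
    (Y : topologicalLmodType R) (U : tvsType R)
    (C : set Y) (D : set U) (c : Y)
    (F : X -> set (\bar Y)) (G : X -> set U)
    (C_cone : convex_cone C) (C_int : C° !=set0) (C_int_proper : C° <> setT)
    (U_separated : hausdorff_space U)
    (D_cone : convex_cone D) (D_proper : D <> setT) (D_closed : closed D)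
    (D_int : D° !=set0)
    (c_int : C° c) :
  stable C D c F G ->
  Sup C (\bigcup_us dual_objective C D c F G us) =
  Inf C (\bigcup_(x in feasible D G) F x).
Proof.
rewrite /stable value_map0//; set P := \bigcup_(x in _) _ => -[Wy WNy subW].
have PT : up C P <> setT.
  by move=> /(Inf_NyP C_cone c_int)/Inf_infinite PT; apply: WNy; exact: PT.
have P0 : up C P <> set0.
  by move=> /(Inf_yP C_cone c_int)/Inf_infinite P0; apply: Wy; exact: P0.
have PNy : ~ P -oo%E.
  by move=> PNy; apply: PT; rewrite -subTset => y _; left.
apply: (Sup_eq_Inf C_cone c_int PT P0).
- move=> [us _ /(Inf_yP C_cone c_int) L0]; apply: P0.
  by rewrite -subset0 -L0; exact: weak_duality.
- move=> z [us _ /(Inf_finP C_cone c_int)[_ nLz]] Pz.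
  by apply: nLz; exact: weak_duality Pz.
move=> y Py; have [us [_]] := subW y Py.
rewrite linear0 scale0r subr0 => /(Inf_finP C_cone c_int)[_ nVy].
move: Py => /(Inf_finP C_cone c_int)[clPy _].
exists us => //; apply/(Inf_finP C_cone c_int); split.
  by move=> k /clPy; exact: weak_duality.
by move=> /(value_map_bound C_cone c_int)/nVy.
Qed.
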